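(* Let $\zeta_3$ be a primitive cube root of unity. Then \[ \sum_{n=0}^\infty\sum_{m=-\infty}^\infty\overline{M}(m,n)\zeta_3^mq^n=\overline{M}_{0,3}(q^3)+q\overline{M}_{1,3}(q^3)+q^2\overline{M}_{2,3}(q^3), \] where \[ \overline{M}_{0,3}(q)=\frac{(q^3;q^3)_\infty^4(q^2;q^2)_\infty}{(q;q)_\infty^2(q^6;q^6)_\infty^2},\quad \overline{M}_{1,3}(q)=-\frac{(q^6;q^6)_\infty(q^3;q^3)_\infty}{(q;q)_\infty},\quad \overline{M}_{2,3}(q)=-2\frac{(q^6;q^6)_\infty^4}{(q^3;q^3)_\infty^2(q^2;q^2)_\infty}. \]
   Context: $(a;q)_\infty=\prod_{k\ge0}(1-aq^k)$. The numbers $\overline{M}(m,n)$ are defined by \[ \sum_{n\ge0}\sum_{m}\overline{M}(m,n)z^mq^n=\frac{(-q;q)_\infty(q;q)_\infty}{(zq;q)_\infty(z^{-1}q;q)_\infty}. \] *)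

(* Defs.v *)
From mathcomp Require Import all_boot all_order all_algebra all_field.
Set Implicit Arguments. Unset Strict Implicit. Unset Printing Implicit Defensive.
Import Order.TTheory GRing.Theory Num.Theory.
Local Open Scope ring_scope.

(* Formal power series in q are handled through truncations: a series S is
   given by a family T : nat -> {poly R} such that T N agrees with S modulo
   q^N.  The coefficient of q^n of S is then (T n.+1)`_n. *)
Definition sercoef {R : nzRingType} (T : nat -> {poly R}) (n : nat) : R :=
  (T n.+1)`_n.

(* Truncation of (a q^s; q^t)_oo = prod_{k>=0} (1 - a q^(s+t k)):
   exact modulo q^N when t >= 1. *)
Definition poch {R : nzRingType} (a : R) (s t N : nat) : {poly R} :=
  \prod_(k < N) (1 - a *: 'X^(s + t * k)).

(* Truncation of 1 / (a q^s; q^t)_oo = prod_k sum_j (a q^(s+tk))^j: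
   exact modulo q^N when s >= 1 and t >= 1. *)
Definition ipoch {R : nzRingType} (a : R) (s t N : nat) : {poly R} :=
  \prod_(k < N) \sum_(j < N) (a *: 'X^(s + t * k)) ^+ j.

(* Coefficient ring for the variable z: Laurent polynomials in z are encoded
   in {poly {poly int}} with inner variable z and outer variable w standing for
   z^-1; the monomial z^i w^j contributes to z^(i-j).  (The map z|->z,
   w|->z^-1 is a ring morphism to Laurent polynomials, so coefficients are
   computed correctly.) *)
Definition zvar : {poly {poly int}} := ('X : {poly int})%:P.
Definition wvar : {poly {poly int}} := 'X.

Definition Mbar_gen (N : nat) : {poly {poly {poly int}}} :=
  poch (-1) 1 1 N * poch 1 1 1 N * ipoch zvar 1 1 N * ipoch wvar 1 1 N.

Definition Mbar (m : int) (n : nat) : int :=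
  let c := sercoef Mbar_gen n in
  \sum_(j < size c) \sum_(i < size c`_j)
     (if (i%:Z - j%:Z == m) then (c`_j)`_i else 0).

Definition Mbar03 (N : nat) : {poly int} :=
  poch 1 3 3 N ^+ 4 * poch 1 2 2 N * ipoch 1 1 1 N ^+ 2 * ipoch 1 6 6 N ^+ 2.
Definition Mbar13 (N : nat) : {poly int} :=
  - (poch 1 6 6 N * poch 1 3 3 N * ipoch 1 1 1 N).
Definition Mbar23 (N : nat) : {poly int} :=
  - (2 * (poch 1 6 6 N ^+ 4 * ipoch 1 3 3 N ^+ 2 * ipoch 1 2 2 N)).

Definition dissection_rhs (N : nat) : {poly int} :=
  Mbar03 N \Po 'X^3 + 'X * (Mbar13 N \Po 'X^3) + 'X^2 * (Mbar23 N \Po 'X^3).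

(* Main.v *)
(* Specializing z to a primitive cube root of unity turns the generating
   function into f1 f2 / f3, where fk = (q^k; q^k)_oo, because
   (1 - t)(1 - zeta t)(1 - t/zeta) = 1 - t^3. Moreover f1 f2 = phi(-q) psi(q)
   with phi(-q) = sum_(j in Z) (-1)^j q^(j^2) = f1^2 / f2 and
   2 psi(q) = sum_(j in Z) q^(j(j+1)/2) = 2 f2^2 / f1. Splitting both sums
   according to j mod 3 gives
     phi(-q) = phi(-q^9) - 2 q Omega(-q^3),   psi(q) = chi(q^3) + q psi(q^9),
   each piece being again a product by the Jacobi triple product identity;
   multiplying the two dissections gives the result.
   Series modulo q^N are elements of commutative rings with an element x such
   that x^N = 0, finally the quotient of algC[X] by X^N. *)
Require Import Defs.
From HB Require Import structures.
From mathcomp Require Import all_boot all_order all_algebra all_field zify ring.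
Import Order.TTheory GRing.Theory Num.Theory.
Local Open Scope ring_scope.

(** * Triangular numbers, q-products and theta sums *)

(* [j (j + 1) / 2] for every integer [j]; recall [Negz n = - (n + 1)]. *)
Definition tri (j : int) : nat :=
  match j with Posz n | Negz n => 'C(n.+1, 2) end.

Lemma triE (j : int) : (tri j)%:Z * 2 = j * (j + 1).
Proof.
have bin2E (n : nat) : ('C(n.+1, 2))%:Z * 2 = (n%:Z + 1) * n%:Z.
  by have := mul_bin_diag n.+1 1; rewrite [n.+1.-1]/= bin1; lia.
by case: j => n /=; rewrite bin2E ?NegzE; lia.
Qed.

Lemma tri_opp (j : int) : tri (- j) = tri (j - 1).
Proof. by have := triE (- j); have := triE (j - 1); lia. Qed.

(** Makes theta terms far from the centre vanish in a nilpotent ring. The inequality on [j] is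
    strict because [tri (-1) = 0]. *)
Lemma leq_tri (N : nat) (j : int) : (N < `|j|)%N -> (N <= tri j)%N.
Proof. by have := triE j; nia. Qed.

Definition qpoch {A : comNzRingType} (a q : A) (n : nat) : A :=
  \prod_(k < n) (1 - a * q ^+ k).

(** The Gaussian binomial, given by a q-Pascal rule rather than a quotient so that it makes sense in
    every commutative ring. *)
Fixpoint qbinom {A : comNzRingType} (q : A) (m k : nat) : A :=
  match k, m with
  | 0, _ => 1
  | k'.+1, 0 => 0
  | k'.+1, m'.+1 => qbinom q m' k' + q ^+ k'.+1 * qbinom q m' k'.+1
  end.

Definition theta_term {A : comNzRingType} (a b : A) (j : int) : A :=
  a ^+ tri j * b ^+ tri (- j).

(* Truncates Ramanujan's
   f(a, b) = sum_(j in Z) a^(j(j+1)/2) b^(j(j-1)/2) to |j| <= n. *)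
Definition theta {A : comNzRingType} (a b : A) (n : nat) : A :=
  \sum_(i < (n + n).+1) theta_term a b (i%:Z - n%:Z).

(** * Gaussian binomials and the finite triple product *)

Section QBinomial.
Context {A : comNzRingType}.
Implicit Types a b q x : A.

Lemma qbinom0 q m : qbinom q m 0 = 1.
Proof. by case: m. Qed.

Lemma qbinom_small q m k : (m < k)%N -> qbinom q m k = 0.
Proof.
elim: m k => [|m IHm] [|k] //= lt_mk.
by rewrite !IHm ?mulr0 ?addr0 //; lia.
Qed.

Lemma qbinomE q m k :
  qbinom q m.+1 k.+1 = qbinom q m k + q ^+ k.+1 * qbinom q m k.+1.
Proof. by []. Qed.

(** The dual q-Pascal rule: expand by the defining rule, apply induction to both parts, and regroup.
    The diagonal [k = m] is separate, since induction at [k.+1] would need [k < m]. *)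
Lemma qbinomSS q m k : (k <= m)%N ->
  qbinom q m.+1 k.+1 = q ^+ (m - k) * qbinom q m k + qbinom q m k.+1.
Proof.
elim: m k => [|m IHm] k le_km.
  by case: k le_km => [|k] //= _; rewrite expr0 mulr0 addr0 mul1r addr0.
rewrite qbinomE; case: k le_km => [|k] le_km.
  rewrite {1}IHm // (qbinomE q m 0) !qbinom0 !subn0 !exprS; ring.
move: le_km; rewrite ltnS leq_eqVlt => /predU1P[->|lt_km].
  by rewrite subnn !(qbinom_small _ _ m.+2) // !mulr0 !addr0 mul1r.
rewrite {1}(IHm k (ltnW lt_km)) {1}(IHm k.+1 lt_km).
rewrite (qbinomE q m k) (qbinomE q m k.+1) subSS.
have -> : (m - k = (m - k.+1).+1)%N by lia.
rewrite !exprS; ring.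
Qed.

Lemma qpochS a q n : qpoch a q n.+1 = qpoch a q n * (1 - a * q ^+ n).
Proof. by rewrite /qpoch big_ord_recr. Qed.

(** Division-free form of the quotient formula for Gaussian binomials. *)
Lemma qbinomM q m k :
  qbinom q (m + k) k * qpoch q q k * qpoch q q m = qpoch q q (m + k).
Proof.
elim: k m => [|k IHk] m; first by rewrite addn0 qbinom0 /qpoch big_ord0; ring.
elim: m => [|m IHm].
  have := IHk 0; rewrite add0n !add0n /= (qbinom_small q k k.+1) // => IH.
  rewrite [in RHS]qpochS -IH !qpochS; ring.
have := IHk m.+1; rewrite addSn => IH1.
move: IHm; rewrite addnS => IHm.
rewrite addSn addnS qbinomE (qpochS q q (m + k).+1).
(* The last factor splits as 1 - q^(m+k+2) = (1 - q^(k+1)) + q^(k+1) (1 - q^(m+1)), matching the two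
   terms of the q-Pascal rule. *)
transitivity (
  (1 - q * q ^+ k) * (qbinom q (m + k).+1 k * qpoch q q k * qpoch q q m.+1)
  + q ^+ k.+1 * (1 - q * q ^+ m) *
    (qbinom q (m + k).+1 k.+1 * qpoch q q k.+1 * qpoch q q m)).
  rewrite !(qpochS q q k) !(qpochS q q m); ring.
by rewrite IH1 IHm !exprS exprD; ring.
Qed.

(** Both sides are monomials in [a] and [b], so only exponents are compared. The power of [a * b] is
    the weight in [qbinomSS]; in [theta_termSr] it is the weight in [qbinomE]. *)
Lemma theta_termSl a b (i s r : nat) : (i <= r + s)%N ->
  theta_term a b (i%:Z - s%:Z) * (a * (a * b) ^+ r) =
  (a * b) ^+ (r + s - i) * theta_term a b (i.+1%:Z - s%:Z).
Proof.
move=> le_i; rewrite /theta_term !exprMn.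
have e1 := triE (i%:Z - s%:Z); have e2 := triE (- (i%:Z - s%:Z)).
have e3 := triE (i.+1%:Z - s%:Z); have e4 := triE (- (i.+1%:Z - s%:Z)).
transitivity (a ^+ (tri (i%:Z - s%:Z) + r.+1) * b ^+ (tri (- (i%:Z - s%:Z)) + r)).
  by rewrite !exprD exprS; ring.
transitivity (a ^+ (tri (i.+1%:Z - s%:Z) + (r + s - i)) *
  b ^+ (tri (- (i.+1%:Z - s%:Z)) + (r + s - i))).
  by congr (_ ^+ _ * _ ^+ _); nia.
by rewrite !exprD; ring.
Qed.

Lemma theta_termSr a b (i s : nat) :
  theta_term a b (i%:Z - s%:Z) * (b * (a * b) ^+ s) =
  (a * b) ^+ i * theta_term a b (i%:Z - s.+1%:Z).
Proof.
rewrite /theta_term !exprMn.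
have e1 := triE (i%:Z - s%:Z); have e2 := triE (- (i%:Z - s%:Z)).
have e3 := triE (i%:Z - s.+1%:Z); have e4 := triE (- (i%:Z - s.+1%:Z)).
transitivity (a ^+ (tri (i%:Z - s%:Z) + s) * b ^+ (tri (- (i%:Z - s%:Z)) + s.+1)).
  by rewrite !exprD exprS; ring.
transitivity (a ^+ (tri (i%:Z - s.+1%:Z) + i) * b ^+ (tri (- (i%:Z - s.+1%:Z)) + i)).
  by congr (_ ^+ _ * _ ^+ _); nia.
by rewrite !exprD; ring.
Qed.

(* MacMahon's finite form of the Jacobi triple product; the two q-Pascal rules
   give the induction steps in s and in r. *)
Lemma finite_triple_product a b r s :
  qpoch (- a) (a * b) r * qpoch (- b) (a * b) s =
  \sum_(i < (r + s).+1) qbinom (a * b) (r + s) i * theta_term a b (i%:Z - s%:Z).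
Proof.
elim: r => [|r IHr].
  rewrite {1}/qpoch big_ord0 mul1r add0n.
  elim: s => [|s IHs].
    rewrite /qpoch big_ord0 big_ord1 qbinom0 /theta_term subrr oppr0 /=.
    by rewrite !expr0 !mulr1.
  rewrite qpochS IHs mulNr opprK mulrDr mulr1.
  rewrite [RHS]big_ord_recl qbinom0 mul1r.
  under [X in _ = _ + X]eq_bigr => i _ do rewrite lift0 /= mulrDl.
  rewrite big_split /= addrCA; congr (_ + _).
    by apply: eq_bigr => i _; congr (_ * theta_term _ _ _); lia.
  rewrite [X in _ = _ + X]big_ord_recr /= (qbinom_small _ s s.+1) // mulr0 mul0r addr0.
  rewrite mulr_suml big_ord_recl /= qbinom0 mul1r theta_termSr expr0 mul1r; congr (_ + _).
  by apply: eq_bigr => i _; rewrite /bump add1n -mulrA theta_termSr mulrCA mulrA.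
rewrite qpochS -mulrA [X in _ * X]mulrC mulrA IHr mulNr opprK mulrDr mulr1.
rewrite addSn [RHS]big_ord_recl qbinom0 mul1r.
under [X in _ = _ + X]eq_bigr => i _.
  rewrite lift0 qbinomSS; last by rewrite -ltnS.
  rewrite mulrDl. over.
rewrite big_split /= addrCA addrC; congr (_ + _).
  rewrite big_ord_recl qbinom0 mul1r; congr (_ + _).
  by rewrite big_ord_recr /= (qbinom_small _ (r + s) (r + s).+1) // mul0r addr0.
rewrite mulr_suml; apply: eq_bigr => i _.
by rewrite -mulrA theta_termSl; [ring | rewrite -ltnS].
Qed.
End QBinomial.

(** * The Jacobi triple product in rings with a nilpotent element *)

Section TripleProduct.
Context {A : comNzRingType}.
Implicit Types a b q x y : A.

Lemma expr_nilp x N k : x ^+ N = 0 -> (N <= k)%N -> x ^+ k = 0.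
Proof. by move=> xN /subnKC <-; rewrite exprD xN mul0r. Qed.

Lemma expr_nilpX x N k : x ^+ N = 0 -> (0 < k)%N -> (x ^+ k) ^+ N = 0.
Proof. by move=> xN k_gt0; rewrite -exprM (expr_nilp x N) // leq_pmull. Qed.

Lemma expr_nilpN x N : x ^+ N = 0 -> (- x) ^+ N = 0.
Proof. by move=> xN; rewrite exprNn xN mulr0. Qed.

(** Each geometric sum telescopes to 1 - (a q^k)^N, which is 1 by nilpotency. *)
Lemma qpochV a q N n : a ^+ N = 0 ->
  qpoch a q n * \prod_(k < n) \sum_(j < N) (a * q ^+ k) ^+ j = 1.
Proof.
move=> aN; rewrite -big_split big1 //= => k _.
by rewrite -opprB mulNr -subrX1 exprMn aN mul0r sub0r opprK.
Qed.

Lemma qpoch_stable a q N n : q ^+ N = 0 -> (N <= n)%N ->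
  qpoch a q n = qpoch a q N.
Proof.
move=> qN /subnKC <-; elim: (n - N)%N => [|m IHm]; first by rewrite addn0.
by rewrite addnS qpochS IHm (expr_nilp q N) ?leq_addr // mulr0 subr0 mulr1.
Qed.

Lemma qpoch_split a q m n :
  qpoch a q (n * m) = \prod_(r < m) qpoch (a * q ^+ r) (q ^+ m) n.
Proof.
rewrite /qpoch exchange_big /=; elim: n => [|n IHn]; first by rewrite !big_ord0.
rewrite mulSnr big_split_ord big_ord_recr -IHn; congr (_ * _).
apply: eq_bigr => r _ /=.
by rewrite -mulrA -exprM -exprD mulnC addnC.
Qed.

(** Sorts the factors by exponent modulo [m]; stability absorbs the change of length from [n * m] to
    [n]. *)
Lemma qpoch_dissect a q N n m : q ^+ N = 0 -> (N <= n)%N -> (0 < m)%N ->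
  qpoch a q n = \prod_(0 <= r < m) qpoch (a * q ^+ r) (q ^+ m) n.
Proof.
move=> qN le_Nn m_gt0; rewrite big_mkord -qpoch_split (qpoch_stable _ _ N n) //.
by rewrite (qpoch_stable _ _ N) // (leq_trans le_Nn) // leq_pmulr.
Qed.

Lemma qpoch_sqr a q n :
  qpoch a q n * qpoch (- a) q n = qpoch (a ^+ 2) (q ^+ 2) n.
Proof.
rewrite -big_split; apply: eq_bigr => k _ /=.
by rewrite -exprM mulnC exprM; ring.
Qed.

(** The limit of the finite form with r = s = n. Terms with |j| > N vanish; for the others
    [N + N <= n] keeps both [i] and [n + n - i] at least [N], so the binomial times (q;q)_n is 1. *)
Lemma triple_product a b N n : a ^+ N = 0 -> (N + N <= n)%N ->
  qpoch (- a) (a * b) n * qpoch (- b) (a * b) n * qpoch (a * b) (a * b) n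
  = theta a b n.
Proof.
move=> aN le_n; rewrite finite_triple_product mulr_suml.
have qN : (a * b) ^+ N = 0 by rewrite exprMn aN mul0r.
apply: eq_bigr => i _; set q := a * b in qN *.
have [le_ni|lt_in] := leqP `|i%:Z - n%:Z| N; last first.
  by rewrite /theta_term (expr_nilp a N) ?leq_tri // !(mul0r, mulr0).
rewrite mulrAC -[RHS]mul1r; congr (_ * _).
(* With E = (q;q)_n, stability turns [qbinomM] into binomial * E * E = E; the inverse [I] cancels
   one E. *)
have /= := qpochV q q N n qN; set I := \prod_(k < n) _ => EI.
have := qbinomM q (n + n - i) i; rewrite subnK; last lia.
have stable k : (N <= k)%N -> qpoch q q k = qpoch q q n.
  by move=> le_Nk; rewrite !(qpoch_stable _ _ N) //; lia.
rewrite (stable i) ?(stable (n + n - i)%N) ?(stable (n + n)%N); [|lia..].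
by move=> GEE; rewrite -[LHS]mulr1 -[X in _ * X]EI mulrA GEE.
Qed.
End TripleProduct.

(** * Product forms and 3-dissections of the theta functions *)

Definition euler {A : comNzRingType} (x : A) (n : nat) : A := qpoch x x n.

Section Dissection.
Context {A : comNzRingType}.
Implicit Types a b q x y : A.

Lemma phi_product x N n : x ^+ N = 0 -> (N + N <= n)%N ->
  theta (- x) (- x) n * euler (x ^+ 2) n = euler x n ^+ 2.
Proof.
move=> xN le_n; rewrite -(triple_product _ _ N) ?expr_nilpN //.
rewrite !/euler (qpoch_dissect x x N n 2) //; last lia.
rewrite unlock /= opprK mulrNN !mulr1 expr1 -!expr2; ring.
Qed.

Lemma two_psi_product x N n : x ^+ N = 0 -> (N + N <= n)%N ->
  theta x 1 n * euler x n = (euler (x ^+ 2) n ^+ 2) *+ 2.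
Proof.
move=> xN le_n; rewrite -(triple_product _ _ N) // mulr1.
(* The factor at k = 0 is 1 + 1, and the remaining ones are those of (-x;x). Lengths [N.+1] and [N]
   make them match; [N > 0] gives [N.+1 <= n]. *)
have -> : qpoch (- 1) x n = qpoch (- x) x n *+ 2.
  have N_gt0 : (0 < N)%N.
    by rewrite lt0n; apply: contra_eq_neq xN => ->; exact: oner_neq0.
  rewrite (qpoch_stable (- x) x N) ?(qpoch_stable (- 1) x N.+1) //; [| |lia..].
    rewrite /qpoch big_ord_recl /= expr0 mulN1r opprK.
    rewrite mulrDl mul1r -mulr2n; congr (_ *+ 2).
    by apply: eq_bigr => i _; rewrite /bump add1n exprS !mulNr mul1r.
  by rewrite exprS xN mulr0.
rewrite !/euler -(qpoch_sqr x x); ring.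
Qed.

(** The triple product has base x^6 and residues 1, 5, 0; splitting all Euler products into classes
    modulo 6 makes both sides agree factor by factor. *)
Lemma omega_product x N n : x ^+ N = 0 -> (N + N <= n)%N ->
  theta (- x ^+ 5) (- x) n * euler (x ^+ 2) n * euler (x ^+ 3) n
  = euler x n * euler (x ^+ 6) n ^+ 2.
Proof.
move=> xN le_n; have xkN k := expr_nilpX x N k xN.
have le_Nn : (N <= n)%N by lia.
rewrite -(triple_product _ _ N) ?expr_nilpN ?xkN //.
rewrite !/euler (qpoch_dissect x x N n 6) //.
rewrite (qpoch_dissect (x ^+ 2) (x ^+ 2) N n 3) ?xkN //.
rewrite (qpoch_dissect (x ^+ 3) (x ^+ 3) N n 2) ?xkN //.
rewrite unlock /= !opprK mulrNN.
rewrite -!exprM -!exprS -!exprSr -?exprD !mulr1; ring.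
Qed.

(** Splitting (-x;x) modulo 3 gives two factors of the triple product and (-x^3;x^3); the signs are
    removed by [qpoch_sqr]. *)
Lemma chi_product x N n : x ^+ N = 0 -> (N + N <= n)%N ->
  theta (x ^+ 2) x n * euler x n * euler (x ^+ 6) n
  = euler (x ^+ 2) n * euler (x ^+ 3) n ^+ 2.
Proof.
move=> xN le_n; have xkN k := expr_nilpX x N k xN.
have le_Nn : (N <= n)%N by lia.
rewrite -(triple_product _ _ N) // ?xkN // !/euler.
rewrite -(qpoch_sqr x x) (exprM x 3 2) -(qpoch_sqr (x ^+ 3) (x ^+ 3)).
rewrite (qpoch_dissect (- x) x N n 3) //.
rewrite unlock /= -exprSr !mulNr -exprS -expr2; ring.
Qed.

Lemma sum_reflect (F : int -> A) n :
  \sum_(i < (n + n).+1) F (- (i%:Z - n%:Z)) = \sum_(i < (n + n).+1) F (i%:Z - n%:Z).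
Proof.
rewrite (reindex_inj rev_ord_inj); apply: eq_bigr => i _ /=.
by congr F; have := ltn_ord i; lia.
Qed.

(** The cutoff 3n + 1 makes the range |j| <= 3n + 1 exactly 2n + 1 blocks of three, each centred at
    a multiple of 3. *)
Lemma theta_trisect a b n :
  theta a b (n * 3).+1 = \sum_(i < (n + n).+1)
    (theta_term a b ((i%:Z - n%:Z) * 3 - 1) + theta_term a b ((i%:Z - n%:Z) * 3)
     + theta_term a b ((i%:Z - n%:Z) * 3 + 1)).
Proof.
rewrite /theta; have -> : ((n * 3).+1 + (n * 3).+1).+1 = ((n + n).+1 * 3)%N by lia.
rewrite -(big_mkord xpredT (fun i => theta_term a b (i%:Z - (n * 3).+1%:Z))).
rewrite big_nat_mul big_mkord; apply: eq_bigr => i _.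
have -> : (i.+1 * 3 = (i * 3).+3)%N by rewrite mulSn.
rewrite !big_nat_recr ?big_geq /=; try lia.
by rewrite add0r; congr (theta_term _ _ _ + theta_term _ _ _ + theta_term _ _ _); lia.
Qed.

(** The exponent is j^2, so the classes 1 and -1 modulo 3 are exchanged by j -> -j and contribute
    equally. *)
Lemma phi_dissection y n :
  theta y y (n * 3).+1 =
  theta (y ^+ 9) (y ^+ 9) n + (y * theta (y ^+ 15) (y ^+ 3) n) *+ 2.
Proof.
have t0 j : theta_term y y (j * 3) = theta_term (y ^+ 9) (y ^+ 9) j.
  rewrite /theta_term -!exprM -!exprD; congr (_ ^+ _).
  by move: (triE (j * 3)) (triE (- (j * 3))) (triE j) (triE (- j)); lia.
have t1 j : theta_term y y (j * 3 + 1) = y * theta_term (y ^+ 15) (y ^+ 3) j.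
  rewrite /theta_term -!exprM -!exprD -exprS; congr (_ ^+ _).
  by move: (triE (j * 3 + 1)) (triE (- (j * 3 + 1))) (triE j) (triE (- j)); lia.
have t2 j : theta_term y y (j * 3 - 1) = y * theta_term (y ^+ 15) (y ^+ 3) (- j).
  have k_opp : - j * 3 + 1 = - (j * 3 - 1) by ring.
  by rewrite -t1 k_opp /theta_term opprK mulrC.
rewrite theta_trisect; under eq_bigr => i _ do rewrite t0 t1 t2.
rewrite !big_split /= (sum_reflect (fun j => y * theta_term _ _ j)).
by rewrite -!mulr_sumr -/(theta (y ^+ 9) (y ^+ 9) n) -/(theta (y ^+ 15) (y ^+ 3) n); ring.
Qed.

(** The symmetry j -> -1 - j of [tri] exchanges the classes 0 and -1 modulo 3 and preserves the
    class 1. *)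
Lemma two_psi_dissection y n :
  theta y 1 (n * 3).+1 =
  theta (y ^+ 6) (y ^+ 3) n *+ 2 + y * theta (y ^+ 9) 1 n.
Proof.
have t0 j : theta_term y 1 (j * 3) = theta_term (y ^+ 6) (y ^+ 3) j.
  rewrite /theta_term expr1n mulr1 -!exprM -!exprD; congr (_ ^+ _).
  by move: (triE (j * 3)) (triE j) (triE (- j)); lia.
have t1 j : theta_term y 1 (j * 3 + 1) = y * theta_term (y ^+ 9) 1 j.
  rewrite /theta_term !expr1n !mulr1 -!exprM -exprS; congr (_ ^+ _).
  by move: (triE (j * 3 + 1)) (triE j); lia.
have t2 j : theta_term y 1 (j * 3 - 1) = theta_term (y ^+ 6) (y ^+ 3) (- j).
  rewrite -t0 /theta_term !expr1n; congr (_ ^+ _ * _).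
  by rewrite mulNr tri_opp.
rewrite theta_trisect; under eq_bigr => i _ do rewrite t0 t1 t2.
rewrite !big_split /= (sum_reflect (fun j => theta_term _ _ j)).
by rewrite -!mulr_sumr -/(theta (y ^+ 6) (y ^+ 3) n) -/(theta (y ^+ 9) 1 n); ring.
Qed.

Lemma euler_stable x N n : x ^+ N = 0 -> (N <= n)%N -> euler x n = euler x N.
Proof. exact: qpoch_stable. Qed.

(** [I3], [I6], [I9], [I18] stand for inverse Euler products. Cancellation of 2 is assumed because
    the theta sum available is 2 psi, not psi. *)
Lemma euler_dissection x N (I3 I6 I9 I18 : A) :
  (forall u v : A, u *+ 2 = v *+ 2 -> u = v) -> x ^+ N = 0 ->
  euler (x ^+ 3) N * I3 = 1 -> euler (x ^+ 6) N * I6 = 1 ->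
  euler (x ^+ 9) N * I9 = 1 -> euler (x ^+ 18) N * I18 = 1 ->
  euler x N * euler (x ^+ 2) N =
  euler (x ^+ 6) N * euler (x ^+ 9) N ^+ 4 * I3 * I18 ^+ 2
  - x * euler (x ^+ 9) N * euler (x ^+ 18) N
  - (x ^+ 2 * euler (x ^+ 3) N * euler (x ^+ 18) N ^+ 4 * I6 * I9 ^+ 2) *+ 2.
Proof.
move=> reg2 xN U3 U6 U9 U18; have xkN k := expr_nilpX x N k xN.
(* [K] truncates the dissected sums and [n] the original ones, as trisection requires; both exceed
   the bound of the triple product. *)
pose K := (N + N)%N; pose n := (K * 3).+1.
have le_K : (N + N <= K)%N by []; have le_n : (N + N <= n)%N by rewrite /n; lia.
have le_NK : (N <= K)%N by rewrite /K; lia.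
have le_Nn : (N <= n)%N by lia.
have stab k : (0 < k)%N -> (euler (x ^+ k) n = euler (x ^+ k) N) *
    (euler (x ^+ k) K = euler (x ^+ k) N).
  by move=> k_gt0; split; apply: euler_stable; rewrite ?xkN.
have [I1 U1] : exists I, euler x N * I = 1 by eexists; apply: qpochV xN.
have [I2 U2] : exists I, euler (x ^+ 2) N * I = 1.
  by eexists; apply: (qpochV _ _ N); rewrite xkN.
have divE (u v e i : A) : u * e = v -> e * i = 1 -> u = v * i.
  by move=> <- ei1; rewrite -mulrA ei1 mulr1.
have phi1 : theta (- x) (- x) n = euler x N ^+ 2 * I2.
  have := phi_product x N n xN le_n.
  by rewrite stab // (euler_stable x N n) // => /divE; apply.
have psi1 : theta x 1 n = euler (x ^+ 2) N ^+ 2 *+ 2 * I1.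
  have := two_psi_product x N n xN le_n.
  by rewrite stab // (euler_stable x N n) // => /divE; apply.
have phi9 : theta (- x ^+ 9) (- x ^+ 9) K = euler (x ^+ 9) N ^+ 2 * I18.
  have := phi_product _ N K (xkN 9%N isT) le_K.
  by rewrite -exprM !stab // => /divE; apply.
have psi9 : theta (x ^+ 9) 1 K = euler (x ^+ 18) N ^+ 2 *+ 2 * I9.
  have := two_psi_product _ N K (xkN 9%N isT) le_K.
  by rewrite -exprM !stab // => /divE; apply.
have omega3 : theta (- x ^+ 15) (- x ^+ 3) K =
    euler (x ^+ 3) N * euler (x ^+ 18) N ^+ 2 * I9 * I6.
  have := omega_product _ N K (xkN 3%N isT) le_K.
  by rewrite -!exprM !stab // => /divE/(_ U9)/divE; apply.
have chi3 : theta (x ^+ 6) (x ^+ 3) K =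
    euler (x ^+ 6) N * euler (x ^+ 9) N ^+ 2 * I18 * I3.
  have := chi_product _ N K (xkN 3%N isT) le_K.
  by rewrite -!exprM !stab // => /divE/(_ U18)/divE; apply.
have := phi_dissection (- x) K; rewrite -/n.
have -> : (- x) ^+ 9 = - x ^+ 9 by ring.
have -> : (- x) ^+ 15 = - x ^+ 15 by ring.
have -> : (- x) ^+ 3 = - x ^+ 3 by ring.
rewrite phi1 phi9 omega3 => phi_eq.
have := two_psi_dissection x K; rewrite -/n psi1 chi3 psi9 => psi_eq.
apply: reg2; transitivity (euler x N ^+ 2 * I2 * (euler (x ^+ 2) N ^+ 2 *+ 2 * I1)).
  transitivity ((euler x N * I1) * (euler (x ^+ 2) N * I2) *
    (euler x N * euler (x ^+ 2) N) *+ 2); last by ring.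
  by rewrite U1 U2 !mul1r.
rewrite phi_eq psi_eq.
move: (euler _ _) (euler _ _) (euler _ _) (euler _ _) U3 U6 U9 U18.
move=> {phi_eq psi_eq phi1 psi1 phi9 psi9 omega3 chi3 stab U1 U2}.
move=> e18 e9 e6 e3 U3 U6 U9 U18.
(* The two cross terms are 1 and -2 times [x * e9 * e18] after cancellation, hence the single
   negative middle term. *)
transitivity (
  (e6 * e9 ^+ 4 * I3 * I18 ^+ 2 + x * e9 * e18 * (e9 * I9) * (e18 * I18)
   - (x * e9 * e18 * (e3 * I3) * (e6 * I6) * (e9 * I9) * (e18 * I18)) *+ 2
   - x ^+ 2 * e3 * e18 ^+ 4 * I6 * I9 ^+ 2 *+ 2) *+ 2); first by ring.
by rewrite U3 U6 U9 U18; ring.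
Qed.

Lemma cubic_qpoch x z w n : z * w = 1 -> 1 + z + w = 0 ->
  qpoch (z * x) x n * qpoch (w * x) x n * euler x n = euler (x ^+ 3) n.
Proof.
move=> zw1 zw0; rewrite /euler /qpoch -!big_split; apply: eq_bigr => k _ /=.
rewrite -exprM mulnC exprM; set t := x ^+ k.
transitivity (1 - (1 + z + w) * (x * t) + (z * w + z + w) * (x * t) ^+ 2
  - z * w * (x * t) ^+ 3); first by ring.
by rewrite zw0 zw1 zw0; ring.
Qed.
End Dissection.

(** * Transfer to quotient rings and specialization of z *)

Section Evaluation.
Context {R A : comNzRingType}.
Implicit Types (f : {rmorphism {poly R} -> A}) (c : R).

Lemma rmorph_poch f c s t N :
  f (poch c s t N) = qpoch (f c%:P * f 'X ^+ s) (f 'X ^+ t) N.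
Proof.
rewrite rmorph_prod; apply: eq_bigr => k _.
by rewrite rmorphB rmorph1 -mul_polyC rmorphM rmorphXn exprD exprM mulrA.
Qed.

Lemma rmorph_poch1 f k N : f (poch 1 k k N) = euler (f 'X ^+ k) N.
Proof. by rewrite rmorph_poch polyC1 rmorph1 mul1r. Qed.

Lemma rmorph_pochV f c s t N : (0 < s)%N -> f 'X ^+ N = 0 ->
  f (poch c s t N) * f (ipoch c s t N) = 1.
Proof.
move=> s_gt0 xN; rewrite rmorph_poch /ipoch rmorph_prod.
have sN : (f c%:P * f 'X ^+ s) ^+ N = 0 by rewrite exprMn expr_nilpX ?mulr0.
rewrite -[RHS](qpochV _ (f 'X ^+ t) N N sN); congr (_ * _).
apply: eq_bigr => k _; rewrite rmorph_sum; apply: eq_bigr => j _.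
by rewrite rmorphXn -mul_polyC rmorphM rmorphXn exprD exprM mulrA.
Qed.
End Evaluation.

Lemma in_qpolyXn_coef (R : comNzRingType) n (p q : {poly R}) i : (i <= n)%N ->
  in_qpoly 'X^(n.+1) p = in_qpoly 'X^(n.+1) q -> p`_i = q`_i.
Proof.
move=> le_in /(congr1 (fun u : {poly %/ 'X^(n.+1)} => (u : {poly R})`_i)) /=.
by rewrite !mk_monic_Xn -!Pdiv.RingMonic.take_poly_rmodp !coef_take_poly ltnS le_in.
Qed.

Definition eval_zw {F : fieldType} (z : F) : {poly {poly int}} -> F :=
  horner_eval z^-1 \o map_poly (horner_eval z \o map_poly intr).
HB.instance Definition _ (F : fieldType) (z : F) := GRing.RMorphism.on (@eval_zw F z).

Lemma eval_zw_def (F : fieldType) (z : F) c :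
  eval_zw z c = (map_poly (horner_eval z \o map_poly intr) c).[z^-1].
Proof. by []. Qed.

Lemma eval_zw_zvar (F : fieldType) (z : F) : eval_zw z zvar = z.
Proof. by rewrite eval_zw_def map_polyC hornerC /= /horner_eval map_polyX hornerX. Qed.

Lemma eval_zw_wvar (F : fieldType) (z : F) : eval_zw z wvar = z^-1.
Proof. by rewrite eval_zw_def map_polyX hornerX. Qed.

Lemma eval_zwE (F : fieldType) (z : F) (c : {poly {poly int}}) : z != 0 ->
  eval_zw z c = \sum_(j < size c) \sum_(i < size c`_j)
    ((c`_j)`_i)%:~R * z ^ (i%:Z - j%:Z).
Proof.
move=> z_neq0; rewrite eval_zw_def (horner_coef_wide _ (size_poly _ _)).
apply: eq_bigr => j _; rewrite coef_map /= /horner_eval.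
rewrite (horner_coef_wide _ (size_poly _ _)) mulr_suml; apply: eq_bigr => i _.
by rewrite coef_map /= -mulrA expfzDr // exprVn exprnN.
Qed.

(** Once [K] bounds all exponents, every monomial z^(i-j) is met by exactly one index of the
    symmetric sum, namely [m = i + K - j]. *)
Lemma sum_zw_coef (F : fieldType) (z : F) (c : {poly {poly int}}) : z != 0 ->
  exists K0 : nat, forall K : nat, (K0 <= K)%N ->
  \sum_(m < (K + K).+1)
    (\sum_(j < size c) \sum_(i < size c`_j)
       (if (i%:Z - j%:Z == m%:Z - K%:Z) then (c`_j)`_i else 0))%:~R
    * z ^ (m%:Z - K%:Z) = eval_zw z c.
Proof.
move=> z_neq0; exists (size c + \max_(j < size c) size (c`_j)%R)%N => K le_K.
rewrite eval_zwE //.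
under eq_bigr => m _ do rewrite rmorph_sum mulr_suml.
rewrite exchange_big; apply: eq_bigr => j _ /=.
under eq_bigr => m _ do rewrite rmorph_sum mulr_suml.
rewrite exchange_big; apply: eq_bigr => i _ /=.
have le_i : (i < \max_(j < size c) size (c`_j)%R)%N.
  exact: leq_trans (ltn_ord i) (leq_bigmax j).
have lt_m : (i + K - j < (K + K).+1)%N by lia.
rewrite (bigD1 (Ordinal lt_m)) //= big1 ?addr0 => [|m].
  have -> : ((i + K - j)%N%:Z - K%:Z) = i%:Z - j%:Z by have := ltn_ord j; lia.
  by rewrite eqxx.
rewrite -val_eqE /= => neq_m; case: eqP => [eq_m|_]; last by rewrite mul0r.
by case/eqP: neq_m; lia.
Qed.

Lemma qpoly_mul2I (R : numFieldType) (h : {poly R}) (u v : {poly %/ h}) :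
  u *+ 2 = v *+ 2 -> u = v.
Proof. by rewrite -!scaler_nat; apply: scalerI; rewrite pnatr_eq0. Qed.

Lemma in_qpolyX_nilp (R : comNzRingType) n :
  (in_qpoly 'X^(n.+1) ('X : {poly R})) ^+ n.+1 = 0.
Proof.
rewrite -rmorphXn; apply/val_inj; transitivity (0 : {poly R}) => //.
by rewrite /= mk_monic_Xn Pdiv.RingMonic.rmodpp ?monicXn.
Qed.

Lemma prim3_sum (F : fieldType) (z : F) : 3.-primitive_root z -> 1 + z + z ^+ 2 = 0.
Proof.
move=> z_prim; have := subrX1 z 3; rewrite (prim_expr_order z_prim) subrr.
move/esym/eqP; rewrite mulf_eq0 subr_eq0 -[z]expr1 -(expr0 z) (eq_prim_root_expr z_prim).
by rewrite !big_ord_recl big_ord0 => /eqP <-; rewrite !expr1 addr0 addrA.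
Qed.

(** * Assembly modulo X^(n+1) *)

(* Coefficientwise identity of formal power series in q: for each n the
   (finitely supported) sum over m in Z, taken as the eventually constant
   symmetric partial sums over -K <= m <= K, equals the q^n coefficient of
   the right-hand side. *)
Theorem theorem2p9 (zeta : algC) :
  3.-primitive_root zeta ->
  forall n : nat, exists K0 : nat, forall K : nat, (K0 <= K)%N ->
    \sum_(i < (K + K).+1)
       (Mbar (i%:Z - K%:Z) n)%:~R * zeta ^ (i%:Z - K%:Z)
    = (sercoef dissection_rhs n)%:~R.
Proof.
move=> zeta_prim n; have zeta3 := prim_expr_order zeta_prim.
have zeta_neq0 : zeta != 0.
  by apply: contra_eq_neq zeta3 => ->; rewrite expr0n eq_sym oner_neq0.
have zetaV : zeta^-1 = zeta ^+ 2.
  by apply: (mulfI zeta_neq0); rewrite -exprS divff.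
have [K0 HK0] := sum_zw_coef _ zeta (sercoef Mbar_gen n) zeta_neq0.
exists K0 => K le_K; transitivity (eval_zw zeta (sercoef Mbar_gen n)).
  exact: HK0.
rewrite /sercoef -!coef_map; apply: (in_qpolyXn_coef _ n) => //.
set N := n.+1; pose A : comNzRingType := {poly %/ ('X^N : {poly algC})}.
pose pi : {rmorphism {poly algC} -> A} := in_qpoly 'X^N.
(* [f] specializes z and w on the left side, [g] treats the right side, and [h] includes the
   substitution of q^3 for q. *)
pose f : {rmorphism {poly {poly {poly int}}} -> A} := pi \o map_poly (eval_zw zeta).
pose g : {rmorphism {poly int} -> A} := pi \o map_poly intr.
pose h : {rmorphism {poly int} -> A} := g \o comp_poly 'X^3.
change (f (Mbar_gen N) = g (dissection_rhs N)).
pose x : A := pi 'X; pose y := x ^+ 3.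
have fX : f 'X = x by rewrite /f /= map_polyX.
have gX : g 'X = x by rewrite /g /= map_polyX.
have hX : h 'X = y by rewrite /h /= comp_polyX map_polyXn rmorphXn.
have xN : x ^+ N = 0 by exact: in_qpolyX_nilp.
have yN : h 'X ^+ N = 0 by rewrite hX expr_nilpX.
pose z := f zvar%:P; pose w := f wvar%:P.
have zE : z = pi zeta%:P.
  by rewrite /z /f /= map_polyC; congr (pi _%:P); exact: eval_zw_zvar.
have wE : w = pi (zeta^-1)%:P.
  by rewrite /w /f /= map_polyC; congr (pi _%:P); exact: eval_zw_wvar.
have zw1 : z * w = 1.
  by rewrite zE wE -rmorphM -polyCM divff // rmorph1.
have zw0 : 1 + z + w = 0.
  transitivity (pi (1 + zeta + zeta ^+ 2)%:P); last by rewrite prim3_sum // !rmorph0.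
  by rewrite zE wE zetaV !polyCD polyC1 !rmorphD rmorph1.
pose J k := h (ipoch 1 k k N).
have EJ k : (0 < k)%N -> euler (y ^+ k) N * J k = 1.
  by move=> k_gt0; rewrite -hX -rmorph_poch1 rmorph_pochV.
have EJ1 := EJ 1 isT; have EJ2 := EJ 2 isT; have EJ3 := EJ 3 isT; have EJ6 := EJ 6 isT.
have fE : f (Mbar_gen N) = euler x N * euler (x ^+ 2) N * J 1.
  rewrite /Mbar_gen 3!(rmorphM f).
  set Iz := f (ipoch zvar _ _ _); set Iw := f (ipoch wvar _ _ _).
  have xN' : f 'X ^+ N = 0 by rewrite fX.
  have := rmorph_pochV f zvar 1 1 N isT xN'.
  rewrite rmorph_poch -/z -/Iz fX expr1 => Uz.
  have := rmorph_pochV f wvar 1 1 N isT xN'.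
  rewrite rmorph_poch -/w -/Iw fX expr1 => Uw.
  have E3 := cubic_qpoch x z w N zw1 zw0.
  rewrite rmorph_poch1 rmorph_poch fX expr1 polyCN polyC1 (rmorphN f) (rmorph1 f).
  rewrite mulN1r.
  (* Inserts 1 = (y;y) * [J 1] and expands (y;y) by the cubic identity, so that its zeta factors
     cancel against [Iz] and [Iw]. *)
  rewrite -[X in X = _]mulr1 -EJ1 expr1 -/y -E3 /y /euler -(qpoch_sqr x x).
  transitivity ((qpoch x x N * (qpoch x x N * qpoch (- x) x N) * J 1)
    * (qpoch (z * x) x N * Iz) * (qpoch (w * x) x N * Iw)); first by ring.
  by rewrite Uz Uw !mulr1.
have -> : g (dissection_rhs N) =
    h (Mbar03 N) + x * h (Mbar13 N) + x ^+ 2 * h (Mbar23 N).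
  by rewrite /dissection_rhs !rmorphD !(rmorphM g) gX.
have -> : h (Mbar03 N) =
    euler (y ^+ 3) N ^+ 4 * euler (y ^+ 2) N * J 1 ^+ 2 * J 6 ^+ 2.
  by rewrite /Mbar03 3!(rmorphM h) !(rmorphXn h) !rmorph_poch1 hX.
have -> : h (Mbar13 N) = - (euler (y ^+ 6) N * euler (y ^+ 3) N * J 1).
  by rewrite /Mbar13 (rmorphN h) !(rmorphM h) !rmorph_poch1 hX.
have -> : h (Mbar23 N) = - (2 * (euler (y ^+ 6) N ^+ 4 * J 3 ^+ 2 * J 2)).
  rewrite /Mbar23 (rmorphN h) 3!(rmorphM h) !(rmorphXn h) !rmorph_poch1.
  by rewrite hX (rmorph_nat h).
move: EJ1 EJ2 EJ3 EJ6; rewrite -!exprM !mulnE /= => EJ1 EJ2 EJ3 EJ6.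
have := euler_dissection x N _ _ _ _ (qpoly_mul2I _ _) xN EJ1 EJ2 EJ3 EJ6.
move=> dissect.
transitivity (euler x N * euler (x ^+ 2) N * J 1); first exact: fE.
(* Here [J k] inverts the Euler product of x^(3k). Multiplying by [J 1] leaves e(x^3) * [J 1] = 1 in
   the last term. *)
rewrite dissect; transitivity (
  euler (x ^+ 9) N ^+ 4 * euler (x ^+ 6) N * J 1 ^+ 2 * J 6 ^+ 2
  - x * (euler (x ^+ 18) N * euler (x ^+ 9) N * J 1)
  - x ^+ 2 * (2 * (euler (x ^+ 18) N ^+ 4 * J 3 ^+ 2 * J 2))
    * (euler (x ^+ 3) N * J 1)); first by ring.
by rewrite EJ1; ring.
Qed.
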